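(* Let $X$ be a smooth, complete and connected curve over an algebraically closed field $k$, with function field $\Sigma_X$. Let $\Omega\subset\mathbb A_X$ be a subring which is a field, with $\Sigma_X^*\subset\Omega^*\subset(\Sigma_X^* )^{\perp}$. Then: (1) $\Omega^*$ is discrete in $\mathbb I_X$. (2) The natural map $\Omega^*\to(\Sigma_X^* )^{\perp\!\!\!\perp}$ (the restriction of the projection $\mathbb I_X^1\to\bar{\mathbb I}_X^1$) is injective and its image is discrete. (3) There is a natural injection $\Omega^*/\Sigma_X^*\hookrightarrow\operatorname{Pic}^0(X)$ (induced by sending an idele $\alpha$ to its divisor $D(\alpha)$).
   Context: Notation: $x\in X$ always denotes a closed point of $X$. $v_x$ is the normalized discrete valuation at $x$; $\widehat{\mathcal O}_{X,x}$ is the completion of the local ring at $x$, with maximal ideal $\widehat{\mathfrak m}_x$, fraction field $K_x$ and residue field $k(x)$ ($=k$ here). The adele ring is $\mathbb A_X=\prod'_{x}K_x$ (restricted product with respect to the $\widehat{\mathcal O}_{X,x}$), with the ring topology having as neighborhood base of $0$ the subspaces $U_D=\{\alpha: v_x(\alpha_x)\ge n_x\ \forall x\}$ for divisors $D=\sum n_xx$. The idele group $\mathbb I_X=\mathbb A_X^*$ has the topology induced by $\alpha\mapsto(\alpha,\alpha^{-1})\in\mathbb A_X\times\mathbb A_X$; a basis of neighborhoods of $1$ is given by $V_D=\prod_{x\in\operatorname{supp}D}(1+\widehat{\mathfrak m}_x^{n_x})\times\prod_{x\notin\operatorname{supp}D}\widehat{\mathcal O}_{X,x}^*$ with $D$ effective.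 The divisor of an idele is $D(\alpha)=\sum_xv_x(\alpha_x)x$, and $\mathbb I_X^1$ is the group of ideles with divisor of degree $0$. $\bar{\mathbb I}_X^1=\mathbb I_X^1/\prod_{x}(1+\widehat{\mathfrak m}_x)$ with the quotient topology. Global pairing $\langle\cdot,\cdot\rangle:\mathbb I_X\times\mathbb I_X\to k^*$ (for $k$ algebraically closed): $$\langle\alpha,\beta\rangle=\prod_{x}(-1)^{v_x(\alpha_x)v_x(\beta_x)}\Big(\frac{\alpha_x^{v_x(\beta_x)}}{\beta_x^{v_x(\alpha_x)}}\Big)(x),$$ where $(x)$ denotes the residue class in $k(x)=k$. It induces a pairing on $\bar{\mathbb I}_X^1$. For $G\subset\mathbb I_X^1$, $G^\perp=\{\alpha\in\mathbb I_X^1:\langle\alpha,g\rangle=1\ \forall g\in G\}$; for $G\subset\bar{\mathbb I}_X^1$, $G^{\perp\!\!\!\perp}=\{\alpha\in\bar{\mathbb I}_X^1:\langle\alpha,g\rangle=1\ \forall g\in G\}$. $\Sigma_X^*$ is embedded diagonally in $\mathbb I_X^1$, and is also regarded as a subgroup of $\bar{\mathbb I}_X^1$ because $\Sigma_X^*\cap\prod_x(1+\widehat{\mathfrak m}_x)=\{1\}$. $(\Sigma_X^* )^{\perp\!\!\!\perp}$ is the image of $(\Sigma_X^* )^\perp$ in $\bar{\mathbb I}_X^1$, with the subspace topology. $\operatorname{Pic}^0(X)$ is the group of degree-zero divisors modulo principal divisors. *)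

(* Defs.v *)
From HB Require Import structures.
From mathcomp Require Import all_boot all_order all_algebra.
From mathcomp Require Import generic_quotient ring_quotient monoid.
From mathcomp Require Import all_classical topology.
From mathcomp.multinomials Require Import freeg.

Set Implicit Arguments.
Unset Strict Implicit.
Unset Printing Implicit Defensive.

Import Order.TTheory GRing.Theory Num.Theory.
Local Open Scope classical_set_scope.
Local Open Scope ring_scope.
Local Open Scope quotient_scope.

(* Normalized discrete valuations.  The value at 0 (mathematically +oo) is
   junk; [vge v n a] is the statement v(a) >= n with the convention
   v(0) = +oo. *)
Record dvaluation (F : fieldType) := DValuation {
  dval :> F -> int;
  dvalM : forall a b, a != 0 -> b != 0 -> dval (a * b) = dval a + dval b;
  dvalD : forall a b, a != 0 -> b != 0 -> a + b != 0 ->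
    Num.min (dval a) (dval b) <= dval (a + b);
  dval_normalized : exists2 t, t != 0 & dval t = 1
}.

Definition vge (F : fieldType) (v : dvaluation F) (n : int) (a : F) : bool :=
  (a == 0) || (n <= v a).

(* The completion of (F, v), given by its universal characterization: a
   complete discretely valued field containing F as a dense valued subfield.
   It is unique up to a unique isomorphism.  If O is the valuation ring of v,
   then { vge cval 0 } is the completion of O, { vge cval 1 } its maximal
   ideal, and cfield its fraction field. *)
Record completion (F : fieldType) (v : dvaluation F) := Completion {
  cfield :> fieldType;
  cval : dvaluation cfield;
  cemb : {rmorphism F -> cfield};
  cval_emb : forall f, f != 0 -> cval (cemb f) = v f;
  cemb_dense : forall (a : cfield) (n : int), exists f, vge cval n (a - cemb f);
  cval_complete : forall u : nat -> cfield,
    (forall n : int, exists N : nat, forall i j : nat, (N <= i)%N -> (N <= j)%N ->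
       vge cval n (u i - u j)) ->
    exists a, forall n : int, exists N : nat, forall i : nat, (N <= i)%N ->
       vge cval n (u i - a)
}.

Section Subrings.
Variables (k F : fieldType) (sc : {rmorphism k -> F}).

Definition is_subalgebra (A : set F) : Prop :=
  [/\ forall c, A (sc c),
      forall a b, A a -> A b -> A (a - b)
    & forall a b, A a -> A b -> A (a * b)].

Definition generated_algebra (s : seq F) : set F :=
  smallest is_subalgebra [set` s].

Definition is_ideal (A I : set F) : Prop :=
  [/\ I `<=` A, I 0,
      forall a b, I a -> I b -> I (a + b)
    & forall a b, A a -> I b -> I (a * b)].

Definition is_maximal_ideal (A m : set F) : Prop :=
  [/\ is_ideal A m, ~ m 1
    & forall J, is_ideal A J -> m `<=` J -> ~ J 1 -> J `<=` m].

Definition localization (A m : set F) : set F :=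
  [set f | exists a b, [/\ A a, A b, ~ m b & f = a / b]].

Definition nonunits (O : set F) : set F :=
  [set f | O f /\ (f != 0 -> ~ O f^-1)].

Definition is_valuation_ring (V : set F) : Prop :=
  is_subalgebra V /\ (forall f, f != 0 -> V f \/ V f^-1).

Definition dominates (V O : set F) : Prop :=
  O `<=` V /\ nonunits O `<=` nonunits V.

Definition transcendental (t : F) : Prop :=
  forall p : {poly k}, (map_poly sc p).[t] = 0 -> p = 0.

Definition algebraically_dependent (t f : F) : Prop :=
  exists2 P : {poly {poly k}}, P != 0 &
    (map_poly (fun p : {poly k} => (map_poly sc p).[t]) P).[f] = 0.

Definition transcendence_degree_one : Prop :=
  exists2 t, transcendental t & forall f, algebraically_dependent t f.

End Subrings.

(* An integral separated scheme of finite type and of dimension 1 over k, in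
   Chevalley's form: it is given by its function field and by the local rings
   of its closed points, as subrings of the function field.
   - [charts_cover]: the scheme is covered by finitely many Spec A, where A is
     a finitely generated k-algebra with fraction field [fun_field]; its closed
     points are those of the charts, i.e. the maximal ideals m of the A's, and
     the local ring at m is A_m;
   - [stalk_separated]: no valuation ring has two centers;
   - the dimension is the transcendence degree of the function field.
   A smooth connected curve is integral, so connectedness is built in. *)
Record curve (k : closedFieldType) := Curve {
  fun_field : fieldType;
  scal : {rmorphism k -> fun_field};
  pt : choiceType;
  stalk : pt -> set fun_field;
  charts_cover : exists charts : seq (seq fun_field),
    [/\ forall s, s \in charts -> forall f, exists a b,
          [/\ generated_algebra scal s a, generated_algebra scal s b,
              b != 0 & f = a / b],
        forall x, exists2 s, s \in charts & exists2 m,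
          is_maximal_ideal (generated_algebra scal s) m &
          stalk x = localization (generated_algebra scal s) m
      & forall s m, s \in charts ->
          is_maximal_ideal (generated_algebra scal s) m ->
          exists x, stalk x = localization (generated_algebra scal s) m];
  stalk_separated : forall (V : set fun_field) (x y : pt),
    is_valuation_ring scal V ->
    dominates V (stalk x) -> dominates V (stalk y) -> x = y;
  curve_dim : transcendence_degree_one scal
}.

(* Smoothness over the algebraically closed field k: every local ring at a
   closed point is regular of dimension 1, i.e. a discrete valuation ring, with
   normalized valuation [ord x].  Completeness is the valuative criterion: every
   valuation ring of the function field over k has a center (the trivial one is
   centered at the generic point). *)
Record smooth_complete_curve (k : closedFieldType) := SmoothCompleteCurve {
  curve_of :> curve k;
  ord : pt curve_of -> dvaluation (fun_field curve_of);
  smooth : forall x, stalk x = [set f | vge (ord x) 0 f];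
  complete : forall V : set (fun_field curve_of),
    is_valuation_ring (scal curve_of) V -> V <> setT ->
    exists x, dominates V (@stalk _ curve_of x)
}.

Section ValuationTheory.
Variables (F : fieldType) (v : dvaluation F).

Lemma dval1 : v 1 = 0.
Proof.
have /eqP := dvalM v (oner_neq0 F) (oner_neq0 F).
by rewrite mulr1 -subr_eq0 opprD addrA subrr sub0r oppr_eq0 => /eqP.
Qed.

Lemma dvalV a : a != 0 -> v a^-1 = - v a.
Proof.
move=> a0; apply/eqP; rewrite -addr_eq0 addrC -dvalM ?invr_eq0 //.
by rewrite divff // dval1.
Qed.

Lemma dvalN a : v (- a) = v a.
Proof.
have vN1 : v (-1) = 0.
  have n1 : (-1 : F) != 0 by rewrite oppr_eq0 oner_eq0.
  have /eqP := dvalM v n1 n1; rewrite mulrNN mulr1 dval1 eq_sym -mulr2n.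
  by rewrite mulrn_eq0 => /eqP.
have [->|a0] := eqVneq a 0; first by rewrite oppr0.
by rewrite -mulN1r dvalM ?vN1 ?add0r // oppr_eq0 oner_eq0.
Qed.

Lemma vge0 n : vge v n 0. Proof. by rewrite /vge eqxx. Qed.

Lemma vgeN n a : vge v n (- a) = vge v n a.
Proof. by rewrite /vge oppr_eq0 dvalN. Qed.

Lemma vgeD n a b : vge v n a -> vge v n b -> vge v n (a + b).
Proof.
rewrite /vge; case: (eqVneq a 0) => [->|a0] /=; first by rewrite add0r.
case: (eqVneq b 0) => [->|b0] /=; first by rewrite addr0 (negPf a0).
case: (eqVneq (a + b) 0) => //= ab0 na nb.
by rewrite (le_trans _ (dvalD _ a0 b0 ab0)) // le_min na nb.
Qed.

Lemma vgeB n a b : vge v n a -> vge v n b -> vge v n (a - b).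
Proof. by move=> na nb; rewrite vgeD ?vgeN. Qed.

Lemma vgeM m n a b : vge v m a -> vge v n b -> vge v (m + n) (a * b).
Proof.
rewrite /vge mulf_eq0; case: (eqVneq a 0) => //= a0.
by case: (eqVneq b 0) => //= b0 na nb; rewrite dvalM // lerD.
Qed.

Lemma vge_le m n a : m <= n -> vge v n a -> vge v m a.
Proof. by move=> mn /orP[a0|na]; rewrite /vge ?a0 // (le_trans mn na) orbT. Qed.

End ValuationTheory.

Section Adeles.
Variables (k : closedFieldType) (X : smooth_complete_curve k).
Variable K : forall x : pt X, completion (ord x).

Definition divisor := {freeg (pt X)}.

Definition prodK := forall x : pt X, K x.

HB.instance Definition _ := Choice.on prodK.

Program Definition prodK_isZmodule := @GRing.isZmodule.Build prodK
  (fun x => 0) (fun a x => - a x) (fun a b x => a x + b x) _ _ _ _.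
Next Obligation. by move=> a b c; apply: functional_extensionality_dep => x; rewrite addrA. Qed.
Next Obligation. by move=> a b; apply: functional_extensionality_dep => x; rewrite addrC. Qed.
Next Obligation. by move=> a; apply: functional_extensionality_dep => x; rewrite add0r. Qed.
Next Obligation. by move=> a; apply: functional_extensionality_dep => x; rewrite addNr. Qed.
HB.instance Definition _ := prodK_isZmodule.

Program Definition prodK_isComPzRing := @GRing.Zmodule_isComPzRing.Build prodK
  (fun x => 1) (fun a b x => a x * b x) _ _ _ _.
Next Obligation. by move=> a b c; apply: functional_extensionality_dep => x; rewrite mulrA. Qed.
Next Obligation. by move=> a b; apply: functional_extensionality_dep => x; rewrite mulrC. Qed.
Next Obligation. by move=> a; apply: functional_extensionality_dep => x; rewrite mul1r. Qed.
Next Obligation. by move=> a b c; apply: functional_extensionality_dep => x; rewrite mulrDl. Qed.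
HB.instance Definition _ := prodK_isComPzRing.

(* All but finitely many components are integral. *)
Definition restricted : {pred prodK} :=
  [pred a : prodK | `[< finite_set [set x | ~~ vge (cval (K x)) 0 (a x)] >] ].

Lemma restricted_subring : GRing.subring_closed restricted.
Proof.
have sub (a b c : prodK) :
    (forall x, vge (cval (K x)) 0 (a x) -> vge (cval (K x)) 0 (b x) ->
               vge (cval (K x)) 0 (c x)) ->
    a \in restricted -> b \in restricted -> c \in restricted.
  move=> h /asboolP fa /asboolP fb; apply/asboolP.
  have fab : finite_set ([set x | ~~ vge (cval (K x)) 0 (a x)] `|`
                         [set x | ~~ vge (cval (K x)) 0 (b x)]).
    by rewrite finite_setU.
  apply: sub_finite_set fab => x /=.
  by case ea: (vge _ _ (a x)); [case eb: (vge _ _ (b x))|];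
    [rewrite h | right | left].
split.
- apply/asboolP; rewrite (_ : [set _ | _] = set0) //.
  by apply/seteqP; split => // x /=; rewrite /vge dval1 lexx orbT.
- by move=> a b; apply: sub => x; apply: vgeB.
- by move=> a b; apply: sub => x va vb; rewrite -[X in vge _ X _]addr0 vgeM.
Qed.

HB.instance Definition _ := GRing.isSubringClosed.Build prodK restricted
  restricted_subring.

Record adele := Adele { adele_val : prodK; _ : adele_val \in restricted }.
HB.instance Definition _ := [isSub for adele_val].
HB.instance Definition _ := [Choice of adele by <:].
HB.instance Definition _ :=
  GRing.SubChoice_isSubComPzRing.Build prodK _ adele restricted_subring.

Lemma adele0E x : val (0 : adele) x = 0. Proof. by []. Qed.
Lemma adele1E x : val (1 : adele) x = 1. Proof. by []. Qed.
Lemma adeleDE (a b : adele) x : val (a + b) x = val a x + val b x. Proof. by []. Qed.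
Lemma adeleNE (a : adele) x : val (- a) x = - val a x. Proof. by []. Qed.
Lemma adeleME (a b : adele) x : val (a * b) x = val a x * val b x. Proof. by []. Qed.

Definition U_ (D : divisor) : set adele :=
  [set a | forall x, vge (cval (K x)) (coeff x D) (val a x)].

Definition adele_nbhs (a : adele) : set_system adele :=
  filter_from [set: divisor] (fun D => [set b | U_ D (b - a)]).

HB.instance Definition _ := hasNbhs.Build adele adele_nbhs.

Lemma U_0 D : U_ D 0.
Proof. by move=> x; rewrite adele0E vge0. Qed.

Lemma U_D D a b : U_ D a -> U_ D b -> U_ D (a + b).
Proof. by move=> Ua Ub x; rewrite adeleDE vgeD. Qed.

Lemma U_I (D E : divisor) : exists G : divisor, U_ G `<=` U_ D `&` U_ E.
Proof.
exists (\sum_(x <- undup (dom D ++ dom E))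
          << Num.max (coeff x D) (coeff x E) *g x >>) => a Ua.
have c x : coeff x (\sum_(x <- undup (dom D ++ dom E))
          << Num.max (coeff x D) (coeff x E) *g x >>)
        = Num.max (coeff x D) (coeff x E).
  rewrite raddf_sum /=; have [xs|xs] := boolP (x \in undup (dom D ++ dom E)).
    rewrite (bigD1_seq x) ?undup_uniq //= coeffU eqxx mulr1 big1 ?addr0 //.
    by move=> y yx; rewrite coeffU (negPf yx) mulr0.
  rewrite big_seq big1 => [|y ys]; last first.
    by rewrite coeffU; case: eqP ys xs => [->->|]; rewrite ?mulr0.
  move: xs; rewrite mem_undup mem_cat negb_or => /andP[xD xE].
  by rewrite !coeff_outdom // maxxx.
by split=> x; apply: vge_le (Ua x); rewrite c le_max lexx ?orbT.
Qed.

Lemma adele_nbhs_filter a : ProperFilter (adele_nbhs a).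
Proof.
apply: filter_from_proper; last by move=> D _; exists a; rewrite /= subrr; exact: U_0.
apply: filter_from_filter; first by exists 0.
move=> D E _ _; have [G GDE] := U_I D E; exists G => // b /GDE[Ub Ub'].
by split.
Qed.

Lemma adele_nbhs_singleton (a : adele) A : adele_nbhs a A -> A a.
Proof. by case=> D _; apply; rewrite /= subrr; exact: U_0. Qed.

Lemma adele_nbhs_nbhs (a : adele) A :
  adele_nbhs a A -> adele_nbhs a (adele_nbhs^~ A).
Proof.
case=> D _ DA; exists D => // b Ub; exists D => // c Uc; apply: DA => /=.
by rewrite -(subrKA b); exact: U_D.
Qed.

HB.instance Definition _ := @Nbhs_isNbhsTopological.Build adele
  adele_nbhs_filter adele_nbhs_singleton adele_nbhs_nbhs.

Record idele := Idele { idele_val : adele; _ : `[< exists b, idele_val * b = 1 >] }.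
HB.instance Definition _ := [isSub for idele_val].
HB.instance Definition _ := [Choice of idele by <:].

Lemma idele_unit (a : idele) : exists b, val a * b = 1.
Proof. exact/asboolP/(valP a). Qed.

Definition mk_idele (a b : adele) (ab1 : a * b = 1) : idele :=
  Idele (introT (asboolP _) (ex_intro _ b ab1)).

Definition idele_inv_val (a : idele) : adele := sval (cid (idele_unit a)).

Lemma idele_mulV (a : idele) : val a * idele_inv_val a = 1.
Proof. exact: svalP (cid (idele_unit a)). Qed.

Lemma idele_mul_subproof (a b : idele) :
  (val a * val b) * (idele_inv_val a * idele_inv_val b) = 1.
Proof. by rewrite mulrACA !idele_mulV mulr1. Qed.

Lemma idele_inv_subproof (a : idele) : idele_inv_val a * val a = 1.
Proof. by rewrite mulrC idele_mulV. Qed.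

Definition idele_one : idele := mk_idele (mulr1 1).
Definition idele_mul (a b : idele) : idele := mk_idele (idele_mul_subproof a b).
Definition idele_inv (a : idele) : idele := mk_idele (idele_inv_subproof a).

Program Definition idele_isGroup := @isGroup.Build idele
  idele_one idele_inv idele_mul _ _ _ _ _.
Next Obligation. by move=> a b c; apply: val_inj; rewrite /= mulrA. Qed.
Next Obligation. by move=> a; apply: val_inj; rewrite /= mul1r. Qed.
Next Obligation. by move=> a; apply: val_inj; rewrite /= mulr1. Qed.
Next Obligation. by move=> a; apply: val_inj; rewrite /= mulrC idele_mulV. Qed.
Next Obligation. by move=> a; apply: val_inj; rewrite /= idele_mulV. Qed.
HB.instance Definition _ := idele_isGroup.

HB.instance Definition _ := Topological.copy idele
  (initial_topology (fun a : idele => (val a, val (a^-1)%g) : adele * adele)).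

Definition icomp (a : idele) (x : pt X) : K x := val (val a) x.

(* D(a) = sum_x v_x(a_x) x; the support is finite since a is an idele. *)
Definition idele_div (a : idele) : divisor :=
  \sum_(x \in [set: pt X]) << cval (K x) (icomp a x) *g x >>.

Definition I1 : set idele := [set a | deg (idele_div a) = 0].

Definition one_units : set idele :=
  [set a | forall x, vge (cval (K x)) 1 (icomp a x - 1)].

Lemma icomp_neq0 (a : idele) x : icomp a x != 0.
Proof.
apply/eqP => a0.
have /(congr1 (fun b : adele => val b x)) := idele_mulV a.
rewrite adeleME adele1E -/(icomp a x) a0 mul0r => /eqP.
by rewrite eq_sym oner_eq0.
Qed.

Lemma icompM (a b : idele) x : icomp (a * b)%g x = icomp a x * icomp b x.
Proof. by []. Qed.

Lemma icompV (a : idele) x : icomp (a^-1)%g x = (icomp a x)^-1.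
Proof.
apply: (mulfI (icomp_neq0 a x)); rewrite divff ?icomp_neq0 // -icompM.
by rewrite divgg.
Qed.

Lemma one_units1 : one_units 1%g.
Proof. by move=> x; rewrite subrr vge0. Qed.

Lemma one_units_val a : one_units a -> forall x, vge (cval (K x)) 0 (icomp a x).
Proof.
move=> ua x; rewrite -(subrK 1 (icomp a x)); apply: vgeD.
  by apply: vge_le (ua x).
by rewrite /vge dval1 lexx orbT.
Qed.

Lemma one_unitsM a b : one_units a -> one_units b -> one_units (a * b)%g.
Proof.
move=> ua ub x; rewrite icompM.
have -> : icomp a x * icomp b x - 1 = icomp a x * (icomp b x - 1) + (icomp a x - 1).
  by rewrite mulrBr mulr1 addrA subrK.
by apply: vgeD => //; rewrite -[X in vge _ X _]add0r vgeM //; exact: one_units_val.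
Qed.

Lemma one_unitsV a : one_units a -> one_units (a^-1)%g.
Proof.
move=> ua x; rewrite icompV.
have a0 := icomp_neq0 a x.
have va : cval (K x) (icomp a x) <= 0.
  rewrite leNgt; apply/negP => h.
  have v1 : vge (cval (K x)) 1 (icomp a x) by rewrite /vge (negPf a0) -gtz0_ge1.
  have := vgeB v1 (ua x); rewrite opprB addrCA subrr addr0.
  by rewrite /vge oner_eq0 dval1.
have -> : (icomp a x)^-1 - 1 = - ((icomp a x)^-1 * (icomp a x - 1)).
  by rewrite mulrBr mulr1 mulVf // opprB.
rewrite vgeN -[X in vge _ X _]add0r vgeM //.
by rewrite /vge dvalV // oppr_ge0 va orbT.
Qed.

(* barI1 is the quotient of I1 by the subgroup one_units, with the quotient of
   the subspace topology of I1. *)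
Definition one_units_eqv : rel I1 :=
  fun a b => `[< one_units (\val a * (\val b)^-1)%g >].

Lemma one_units_eqv_refl : reflexive one_units_eqv.
Proof. by move=> a; apply/asboolP; rewrite mulgV; exact: one_units1. Qed.

Lemma one_units_eqv_sym : symmetric one_units_eqv.
Proof.
have h (a b : I1) : one_units_eqv a b -> one_units_eqv b a.
  by move=> /asboolP /one_unitsV; rewrite invgM invgK => ?; apply/asboolP.
by move=> a b; apply/idP/idP; exact: h.
Qed.

Lemma one_units_eqv_trans : transitive one_units_eqv.
Proof.
move=> b a c /asboolP ab /asboolP bc; apply/asboolP.
by have := one_unitsM ab bc; rewrite mulgA mulgVK.
Qed.

Canonical one_units_equiv := EquivRel one_units_eqv
  one_units_eqv_refl one_units_eqv_sym one_units_eqv_trans.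

Definition barI1 : topologicalType :=
  quotient_topology {eq_quot one_units_equiv}.

Definition bar (a : I1) : barI1 := \pi_{eq_quot one_units_equiv} a.

(* The residue class of an integral element a of K_x in k(x) = k: the c in k
   such that a - c lies in the maximal ideal. *)
Definition residue (x : pt X) (a : K x) : k :=
  xget 0 [set c : k | vge (cval (K x)) 1 (a - cemb (K x) (scal X c))].

Definition local_symbol (x : pt X) (a b : K x) : k :=
  (-1) ^ (cval (K x) a * cval (K x) b) *
  residue (a ^ (cval (K x) b) / b ^ (cval (K x) a)).

(* All but finitely many factors are 1, so this is a finite product. *)
Definition pairing (a b : idele) : k :=
  \big[*%R/1]_(x \in [set: pt X]) local_symbol (icomp a x) (icomp b x).

(* The pairing induced on barI1; it does not depend on representatives. *)
Definition bar_pairing (a b : barI1) : k :=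
  pairing (\val (repr (a : {eq_quot one_units_equiv})))
          (\val (repr (b : {eq_quot one_units_equiv}))).

Definition perp (G : set idele) : set idele :=
  [set a | I1 a /\ forall g, G g -> pairing a g = 1].

Definition bar_perp (G : set barI1) : set barI1 :=
  [set a | forall g, G g -> bar_pairing a g = 1].

(* The diagonal image of the multiplicative group of the function field, in
   the ideles and in barI1 (a nonzero function has finitely many zeros and poles,
   so its diagonal image is an idele). *)
Definition principal : set idele :=
  [set a | exists2 f : fun_field X, f != 0 & forall x, icomp a x = cemb (K x) f].

Definition bar_principal : set barI1 := bar @` [set a : I1 | principal (\val a)].

Definition is_subfield (O : {pred adele}) : Prop :=
  [/\ GRing.subring_closed O, (1 : adele) != 0
    & forall a, a \in O -> a != 0 -> exists2 b, b \in O & a * b = 1].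

Definition units_of (O : {pred adele}) : set idele :=
  [set a : idele | val a \in O /\ val (a^-1)%g \in O].

Definition icoset (G : set idele) (a : idele) : set idele :=
  [set (a * g)%g | g in G].

Definition degree0 : {pred divisor} := [pred D | deg D == 0].

Lemma degree0_zmod : zmod_closed degree0.
Proof.
split; first by rewrite !inE raddf0.
by move=> D E; rewrite !inE raddfB /= => /eqP-> /eqP->; rewrite subr0.
Qed.

HB.instance Definition _ := GRing.isZmodClosed.Build divisor degree0 degree0_zmod.

Record Div0 := MkDiv0 { div0_val : divisor; _ : div0_val \in degree0 }.
HB.instance Definition _ := [isSub for div0_val].
HB.instance Definition _ := [Choice of Div0 by <:].
HB.instance Definition _ := [SubChoice_isSubZmodule of Div0 by <:].

Definition principal_div : {pred Div0} := [pred D : Div0 |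
  `[< exists2 f : fun_field X, f != 0 & forall x, coeff x (val D) = ord x f >] ].

Lemma principal_div_zmod : zmod_closed principal_div.
Proof.
split; first by apply/asboolP; exists 1; rewrite ?oner_eq0 // => x; rewrite dval1 raddf0.
move=> D E /asboolP[f f0 Df] /asboolP[g g0 Eg]; apply/asboolP; exists (f / g).
  by rewrite mulf_neq0 ?invr_eq0.
by move=> x; rewrite !raddfB /= Df Eg dvalM ?invr_eq0 // dvalV.
Qed.

HB.instance Definition _ := GRing.isZmodClosed.Build Div0 principal_div
  principal_div_zmod.

Definition Pic0 : zmodType := Quotient.quot principal_div.

Lemma idele_div_degree0 (a : I1) : idele_div (\val a) \in degree0.
Proof. by have := set_valP a; rewrite /I1 /= inE => ->. Qed.

Definition div_class (a : I1) : Pic0 :=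
  \pi_Pic0 (MkDiv0 (idele_div_degree0 a)).

End Adeles.

Arguments U_ {k X} K D.
Arguments I1 {k X} K.
Arguments principal {k X} K.
Arguments bar_principal {k X} K.
Arguments bar {k X K} a.
Arguments div_class {k X K} a.
Arguments bar_perp {k X K} G.
Arguments Pic0 {k} X.

Definition discrete_subset (T : topologicalType) (A : set T) : Prop :=
  forall a : A, open [set a].

(* Main.v *)
Require Import Defs.
From HB Require Import structures.
From mathcomp Require Import all_boot all_order all_algebra.
From mathcomp Require Import generic_quotient ring_quotient monoid.
From mathcomp Require Import all_classical topology.
From mathcomp Require Import polyXY.
From mathcomp.multinomials Require Import freeg.
Set Implicit Arguments.
Unset Strict Implicit.
Unset Printing Implicit Defensive.
Import Order.TTheory GRing.Theory Num.Theory.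
Local Open Scope classical_set_scope.
Local Open Scope ring_scope.
Local Open Scope quotient_scope.

(* A nonzero w in Omega is invertible in Omega, hence an idele orthogonal to
   Sigma_X^*, hence of degree 0; so w = 0 as soon as v_x(w_x) >= n_x for all x,
   where the n_x are the coefficients of a divisor of positive degree.  For (1)
   and (2) apply this to b - a, where b lies in the neighbourhood
   { b : v_x(b_x - a_x) >= v_x(a_x) + [x = x0] for all x } of a, which is
   stable under multiplication by the one-units.  For (3), let a, b in Omega^*
   have linearly equivalent divisors, and divide a / b by the function realizing
   the equivalence: the quotient c has valuation 0 everywhere and a residue
   l in k^* at x0, and c - l vanishes by the same argument, with n = x0.

   That the residue field at x is k follows from transcendence degree 1
   without the Nullstellensatz: an element with no residue in k is
   transcendental over k, and v_x is trivial on the field it generates. *)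

(** * Valuations: dominant terms and values of polynomials *)

Section Valuations.
Variables (F : fieldType) (v : dvaluation F).

Lemma vge_dval a : vge v (v a) a.
Proof. by rewrite /vge lexx orbT. Qed.

Lemma vge_dvalS a : a != 0 -> vge v (v a + 1) a = false.
Proof. by move=> a0; rewrite /vge (negPf a0) /= gerDl. Qed.

Lemma dval_dominant a b : a != 0 -> vge v (v a + 1) b ->
  a + b != 0 /\ v (a + b) = v a.
Proof.
move=> a0 vb.
have N : ~~ vge v (v a + 1) (a + b).
  apply/negP => /vgeB /(_ vb); rewrite addrK => /idP.
  by rewrite vge_dvalS.
have vb' : vge v (v a) b by apply: vge_le vb; rewrite lerDl.
have := vgeD (vge_dval a) vb'.
move: N; rewrite /vge negb_or => /andP[n0]; rewrite n0 (negPf n0) /=.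
by rewrite -ltNge ltzD1 => le1 le2; split=> //; apply/le_anti/andP.
Qed.

Lemma vge0_dval0 a : vge v 0 a -> ~~ vge v 1 a -> a != 0 /\ v a = 0.
Proof.
rewrite /vge; case: eqVneq => //= a0 va; rewrite -ltNge -[1]add0r ltzD1 => va'.
by split=> //; apply/le_anti/andP.
Qed.

Lemma vge1_mul a b : v a = 0 -> vge v 1 b -> vge v 1 (a * b).
Proof. by move=> va vb; rewrite -[1]add0r; apply: vgeM => //; rewrite -va vge_dval. Qed.

Lemma dvalXz a (n : int) : a != 0 -> v (a ^ n) = n * v a.
Proof.
move=> a0; have nat (m : nat) : v (a ^+ m) = m%:Z * v a.
  elim: m => [|m IH]; first by rewrite expr0 dval1 mul0r.
  by rewrite exprS dvalM ?expf_neq0 // IH -addn1 PoszD mulrDl mul1r addrC.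
case: n => m; first exact: nat.
by rewrite NegzE -exprnN dvalV ?expf_neq0 // nat mulNr.
Qed.

(** Stands in for having coefficients in a subfield on which [v] is trivial. *)
Definition coefs_dval0 (q : {poly F}) := forall i, q`_i != 0 -> v q`_i = 0.

Lemma coefs_dval0_MXaddC q c : coefs_dval0 (q * 'X + c%:P) -> coefs_dval0 q /\ (c != 0 -> v c = 0).
Proof.
move=> h; split=> [i|]; first by have := h i.+1; rewrite coefD coefMX coefC addr0.
by have := h 0%N; rewrite coefD coefMX coefC add0r.
Qed.

(* The terms q_i w^i have pairwise distinct valuations. *)
Lemma horner_coefs_dval0_neq0 w q : w != 0 -> v w != 0 -> q != 0 -> coefs_dval0 q ->
  q.[w] != 0.
Proof.
move=> w0; case: ltgtP => // vw _.
(* For v(w) < 0 the bound v(q(w)) <= 0 is carried through the induction: q(w) w then has negative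
   valuation and dominates the next constant term c. *)
- suff h : q != 0 -> coefs_dval0 q -> q.[w] != 0 /\ v q.[w] <= 0.
    by move=> q0 /h[].
  elim/poly_ind: q => [|q c IH]; first by rewrite eqxx.
  move=> q0 /coefs_dval0_MXaddC[qv cv]; rewrite hornerMXaddC.
  have [qz|qn] := eqVneq q 0.
    move: q0; rewrite qz horner0 !mul0r !add0r polyC_eq0 => c0.
    by rewrite c0 cv.
  have [n0 vle] := IH qn qv.
  have m0 : q.[w] * w != 0 by rewrite mulf_neq0.
  have vlt : v (q.[w] * w) < 0.
    by rewrite dvalM // -[0]addr0 ler_ltD.
  have [||-> ->] := @dval_dominant (q.[w] * w) c => //.
    rewrite /vge; case: (eqVneq c 0) => //= /cv ->.
    by rewrite lezD1.
  by split=> //; exact: ltW.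
(* For v(w) > 0, q(w) is integral, so a nonzero constant term dominates q(w) w; if the constant term
   is 0, w factors out. *)
- have int q' : coefs_dval0 q' -> vge v 0 q'.[w].
    elim/poly_ind: q' => [|q' c IH]; first by rewrite horner0 vge0.
    move=> /coefs_dval0_MXaddC[qv cv]; rewrite hornerMXaddC.
    apply: vgeD.
      rewrite -[0]addr0; apply: vgeM; first exact: IH.
      by rewrite /vge (ltW vw) orbT.
    by rewrite /vge; case: (eqVneq c 0) => //= /cv ->.
  elim/poly_ind: q => [|q c IH]; first by rewrite eqxx.
  move=> q0 /coefs_dval0_MXaddC[qv cv]; rewrite hornerMXaddC.
  have [c0|cn] := eqVneq c 0.
    move: q0; rewrite c0 !addr0 mulf_eq0 polyX_eq0 orbF => qn.
    by rewrite mulf_neq0 // IH.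
  rewrite addrC; have [] // := @dval_dominant c (q.[w] * w) => //.
  rewrite cv //; apply: vgeM; first exact: int.
  by rewrite /vge -gtz0_ge1 vw orbT.
Qed.

End Valuations.

(** * Residues in k when the transcendence degree is 1 *)

Section ResidueField.
Variables (k : closedFieldType) (F : fieldType) (sc : {rmorphism k -> F}).
Variable v : dvaluation F.
Hypothesis sc_int : forall c, vge v 0 (sc c).

Lemma dval_scal c : c != 0 -> v (sc c) = 0.
Proof.
move=> c0; have s0 : sc c != 0 by rewrite fmorph_eq0.
have := sc_int c; have := sc_int c^-1.
rewrite /vge fmorphV invr_eq0 (negPf s0) /= dvalV // oppr_ge0 => h1 h2.
by apply/le_anti/andP.
Qed.

Definition no_residue f := vge v 0 f /\ forall c, ~~ vge v 1 (f - sc c).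

(** Since k is algebraically closed, p splits into factors X - c, and every f - c has valuation
    0. *)
Lemma no_residue_horner f (p : {poly k}) : no_residue f -> p != 0 ->
  (map_poly sc p).[f] != 0 /\ v (map_poly sc p).[f] = 0.
Proof.
case=> f0 nf p0; have [s ps] := closed_field_poly_normal p.
have l0 : lead_coef p != 0 by rewrite lead_coef_eq0.
rewrite ps; move: (lead_coef p) l0 => l l0.
elim: s {ps} => [|c s [IH1 IH2]].
  rewrite big_nil alg_polyC map_polyC hornerC fmorph_eq0 /= l0.
  by rewrite dval_scal.
have [n0 vn] := vge0_dval0 (vgeB f0 (sc_int c)) (nf c).
rewrite big_cons scalerAr rmorphM rmorphB /= map_polyX map_polyC /= hornerM.
rewrite hornerXsubC mulf_neq0 // dvalM // vn add0r.
by [].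
Qed.

Definition eval2 (P : {poly {poly k}}) (x y : F) : F :=
  (map_poly (fun p => (map_poly sc p).[x]) P).[y].

Lemma eval2_swap P x y : eval2 P x y = eval2 (swapXY P) y x.
Proof.
have E Q a b : eval2 Q a b = (swapXY (map_poly (map_poly sc) Q)).[a%:P].[b].
  by rewrite horner_swapXY -map_poly_comp.
by rewrite E horner2_swapXY E swapXY_map swapXYK.
Qed.

(** Together with [eval2_swap], this turns a relation between t and f into one between f and t -
    c. *)
Lemma eval2_shift P x y c :
  eval2 (P \Po ('X + c%:P%:P)) x y = eval2 P x (y + sc c).
Proof.
rewrite /eval2 -/(horner_eval x \o map_poly sc) map_comp_poly horner_comp.
rewrite rmorphD /= map_polyX map_polyC hornerD hornerX hornerC /=.
by rewrite map_polyC /horner_eval hornerC.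
Qed.

(** In the outer variable, P has coefficients P_i(x), each of which is 0 or has valuation 0 by
    [no_residue_horner]. *)
Lemma no_residue_eval2 P x y : no_residue x -> y != 0 -> v y != 0 -> P != 0 ->
  eval2 P x y != 0.
Proof.
move=> nx y0 vy P0.
have cP i : (map_poly (fun p => (map_poly sc p).[x]) P)`_i = (map_poly sc P`_i).[x].
  by rewrite coef_map_id0 // map_poly0 horner0.
apply: (@horner_coefs_dval0_neq0 _ v) => //.
  apply/eqP => /polyP/(_ (size P).-1); rewrite coef0 cP => /eqP; apply/negP.
  by have [] // := @no_residue_horner x P`_(size P).-1 nx _;
    rewrite -lead_coefE lead_coef_eq0.
move=> i; rewrite cP; have [->|Pi0] := eqVneq P`_i 0.
  by rewrite map_poly0 horner0 eqxx.
by have [] := no_residue_horner nx Pi0.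
Qed.

(* An element with no residue in k is algebraically independent of every
   element of nonzero valuation.  If f had no residue, this would force every
   nonzero translate of t by k to have valuation 0, so that t itself would have
   no residue. *)
Lemma residue_exists (trd : transcendence_degree_one sc) f : vge v 0 f ->
  exists c, vge v 1 (f - sc c).
Proof.
move=> f0; apply: contrapT => nex.
have nf : no_residue f.
  by split=> // c; apply/negP => h; apply: nex; exists c.
have [t t_tr alg] := trd.
have [[c [w0 vw]]|Nt] :=
  pselect (exists c, t - sc c != 0 /\ v (t - sc c) != 0).
  have [P P0 /eqP] := alg f; apply/negP; rewrite -/(eval2 P t f).
  rewrite eval2_swap -(subrK (sc c) t) -eval2_shift.
  apply: no_residue_eval2 => //.
  by rewrite comp_poly2_eq0 ?swapXY_eq0 // size_XaddC.
have nt : no_residue t.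
  have tn c : t - sc c != 0.
    apply/negP => /eqP tc; have := @t_tr ('X - c%:P).
    rewrite rmorphB /= map_polyX map_polyC hornerXsubC tc => /(_ erefl)/eqP.
    by rewrite polyXsubC_eq0.
  have vt c : v (t - sc c) = 0.
    by apply/eqP/negPn/negP => h; apply: Nt; exists c.
  split; first by rewrite -[t]subr0 -(rmorph0 sc) /vge vt orbT.
  by move=> c; rewrite /vge vt (negPf (tn c)).
(* A uniformizer has nonzero valuation, yet it is algebraically dependent on t: this is the
   contradiction. *)
have [u u0 vu] := dval_normalized v.
have [P P0 /eqP] := alg u; apply/negP.
by apply: (no_residue_eval2 nt) => //; rewrite vu.
Qed.

End ResidueField.

(** * Discrete subsets *)

Lemma discrete_subsetP (T : topologicalType) (A : set T) :
  (forall a, A a -> exists2 U, open U & U a /\ forall b, A b -> U b -> b = a) ->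
  discrete_subset A.
Proof.
move=> h a; have [U oU [Ua Uu]] := h (\val a) (set_valP a).
exists U => //; apply/seteqP; split=> [b Ub|b ->] //.
by apply: val_inj; apply: Uu => //; exact: set_valP.
Qed.

(** Serves statement (2), where discreteness is meant inside the subspace orthogonal to the
    principal classes. *)
Lemma discrete_subset_preimage (T : topologicalType) (A B : set T) :
  (forall a, A a -> exists2 U, open U & U a /\ forall b, A b -> U b -> b = a) ->
  discrete_subset (\val @^-1` A : set B).
Proof.
move=> h; apply: discrete_subsetP => a Aa; have [U oU [Ua Uu]] := h _ Aa.
exists (\val @^-1` U); first by exists U.
by split=> // b Ab Ub; apply: val_inj; exact: Uu.
Qed.

(** * Coefficients and degrees of divisors *)

Section Freeg.
Variable T : choiceType.

Lemma coeff_fsum (f : T -> int) x : finite_set [set y | f y != 0] ->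
  coeff x (\sum_(y \in [set: T]) << f y *g y >>) = f x.
Proof.
move=> fin; rewrite (fsbigTE (fset_set [set y | f y != 0])); last first.
  by move=> y; rewrite in_fset_set // notin_setE /= => /negP/negPn/eqP ->; rewrite freegU0.
rewrite raddf_sum /=; have [fx|fx] := eqVneq (f x) 0.
  rewrite fx big1 // => y _; rewrite coeffU.
  by case: eqVneq => [->|]; rewrite ?fx ?mul0r ?mulr0.
rewrite (bigD1_seq x) //=; last by rewrite in_fset_set // inE.
rewrite coeffU eqxx mulr1 big1 ?addr0 // => y /negPf yx.
by rewrite coeffU yx mulr0.
Qed.

Lemma deg_sum (D : {freeg T}) : deg D = \sum_(x <- dom D) coeff x D.
Proof.
rewrite -{1}[D]freeg_sumE raddf_sum /=; apply: eq_bigr => x _; exact: degU.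
Qed.

Lemma deg_ge0 (D : {freeg T}) : (forall x, 0 <= coeff x D) -> 0 <= deg D.
Proof. by move=> D0; rewrite deg_sum sumr_ge0. Qed.

Lemma deg_le (D E : {freeg T}) : (forall x, coeff x D <= coeff x E) -> deg D <= deg E.
Proof.
move=> DE; rewrite -subr_ge0 -degB; apply: deg_ge0 => x.
by rewrite coeffB subr_ge0.
Qed.

End Freeg.

(** * Divisors of ideles, open sets, and the pairing modulo one-units *)

Section Ideles.
Variables (k : closedFieldType) (X : smooth_complete_curve k).
Variable K : forall x : pt X, completion (ord x).
Implicit Types (a b u g : idele K) (x : pt X).

(** Where the valuation is nonzero, either a or its inverse fails to be integral. *)
Lemma finite_idele_supp a : finite_set [set x | cval (K x) (icomp a x) != 0].
Proof.
have /asboolP fa := valP (val a); have /asboolP fb := valP (val (a^-1)%g).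
have : finite_set ([set x | ~~ vge (cval (K x)) 0 (icomp a x)] `|`
                   [set x | ~~ vge (cval (K x)) 0 (icomp a^-1%g x)]).
  by rewrite finite_setU.
apply: sub_finite_set => x /=; rewrite icompV /vge dvalV ?icomp_neq0 //.
rewrite (negPf (icomp_neq0 a x)) (negPf (invr_neq0 (icomp_neq0 a x))) /= oppr_ge0.
by rewrite neq_lt -!ltNge => /orP.
Qed.

Lemma coeff_idele_div a x : coeff x (idele_div a) = cval (K x) (icomp a x).
Proof. exact/(coeff_fsum (f := fun y => _))/finite_idele_supp. Qed.

Lemma idele_divM a b : idele_div (a * b)%g = idele_div a + idele_div b.
Proof.
apply/eqP/freeg_eqP => x.
by rewrite coeffD !coeff_idele_div icompM dvalM ?icomp_neq0.
Qed.

Lemma val_ideleV a (c : adele K) : val a * c = 1 -> val (a^-1)%g = c.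
Proof.
have Va : val (a^-1)%g * val a = 1 := congr1 val (mulVg a).
move=> ac; transitivity (val (a^-1)%g * (val a * c)); first by rewrite ac mulr1.
by rewrite mulrA Va mul1r.
Qed.

Lemma open_U_coset D (c : adele K) : open [set b | U_ K D (b - c)].
Proof.
rewrite openE => b /= Ub; exists D => // d Ud /=.
by rewrite -(subrKA b); exact: U_D.
Qed.

Lemma open_idele_coset D (c : adele K) : open [set b : idele K | U_ K D (val b - c)].
Proof.
exists (fst @^-1` [set b : adele K | U_ K D (b - c)] : set (adele K * adele K)) => //.
by by apply: open_comp (@open_U_coset D c) => p _; exact: cvg_fst.
Qed.

Lemma one_units_dval0 u x : one_units u -> cval (K x) (icomp u x) = 0.
Proof.
move=> uu; have := one_units_val (one_unitsV uu) x; have := one_units_val uu x.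
rewrite /vge icompV invr_eq0 (negPf (icomp_neq0 u x)) dvalV ?icomp_neq0 //=.
by rewrite oppr_ge0 => h1 h2; apply/le_anti/andP.
Qed.

Lemma one_units_exp u x (n : int) : one_units u ->
  vge (cval (K x)) 1 (icomp u x ^ n - 1).
Proof.
have nat w (m : nat) : one_units w -> vge (cval (K x)) 1 (icomp w x ^+ m - 1).
  move=> uw; elim: m => [|m IH]; first by rewrite expr0 subrr vge0.
  have -> : icomp w x ^+ m.+1 - 1 =
      icomp w x * (icomp w x ^+ m - 1) + (icomp w x - 1).
    by rewrite mulrBr mulr1 addrA subrK exprS.
  by apply: vgeD => //; apply: vge1_mul => //; exact: one_units_dval0.
move=> uu; case: n => m; first exact: nat.
by rewrite NegzE -exprnN -exprVn -icompV; apply: nat; exact: one_unitsV.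
Qed.

Lemma residue_congr x (a b : K x) : vge (cval (K x)) 1 (a - b) ->
  residue a = residue b.
Proof.
move=> ab; rewrite /residue; congr xget; apply/seteqP; split=> c /= h.
  rewrite -[b](subKr a) -addrA [- _ - _]addrC addrA.
  by apply: vgeB.
by rewrite -(subrKA b) vgeD.
Qed.

(** One-units do not change valuations, and they multiply the quotient inside the residue by an
    element of 1 + m. *)
Lemma local_symbol_congr a a' b b' x :
  one_units (a * a'^-1)%g -> one_units (b * b'^-1)%g ->
  local_symbol (icomp a x) (icomp b x) = local_symbol (icomp a' x) (icomp b' x).
Proof.
set u := (a * _)%g; set w := (b * _)%g => uu uw.
have -> : a = (u * a')%g by rewrite mulgVK.
have -> : b = (w * b')%g by rewrite mulgVK.
move: u w uu uw => u w uu uw; rewrite /local_symbol !icompM.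
rewrite !dvalM ?icomp_neq0 // !(one_units_dval0 _ uu) !(one_units_dval0 _ uw).
rewrite !add0r; congr (_ * _); apply: residue_congr.
set m := cval _ (icomp a' x); set n := cval _ (icomp b' x).
(* The valuation of c is n m - m n = 0, so c e - c = c (e - 1) lies in m once e - 1 does. *)
pose c := icomp a' x ^ n / icomp b' x ^ m.
pose e := icomp u x ^ n / icomp w x ^ m.
have -> : (icomp u x * icomp a' x) ^ n / (icomp w x * icomp b' x) ^ m = c * e.
  by rewrite !expfzMl invfM mulrACA [e * c]mulrC.
rewrite -/c -[X in _ - X]mulr1 -mulrBr; apply: vge1_mul.
  rewrite dvalM ?invr_eq0 ?expfz_neq0 ?icomp_neq0 //.
  by rewrite dvalV ?expfz_neq0 ?icomp_neq0 // !dvalXz ?icomp_neq0 // mulrC subrr.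
have -> : e - 1 = (icomp w x ^ m)^-1 * ((icomp u x ^ n - 1) - (icomp w x ^ m - 1)).
  rewrite opprB addrA subrK mulrBr mulVf ?expfz_neq0 ?icomp_neq0 //.
  by rewrite [_^-1 * _]mulrC.
apply: vge1_mul; last by apply: vgeB; exact: one_units_exp.
rewrite dvalV ?expfz_neq0 ?icomp_neq0 // dvalXz ?icomp_neq0 //.
by rewrite one_units_dval0 // mulr0 oppr0.
Qed.

Lemma pairing_congr a a' b b' :
  one_units (a * a'^-1)%g -> one_units (b * b'^-1)%g ->
  pairing a b = pairing a' b'.
Proof.
move=> ua ub; rewrite /pairing; apply: eq_fsbigr => x _.
exact: local_symbol_congr.
Qed.

Lemma repr_one_units (a : I1 K) :
  one_units (\val (repr (bar a : {eq_quot (one_units_equiv K)})) * (\val a)^-1)%g.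
Proof.
apply/asboolP; rewrite -[`[< _ >]]/(one_units_equiv K _ _).
by apply/eqmodP; rewrite reprK.
Qed.

(** The representatives chosen by [repr] differ from a and b by one-units, which the pairing does
    not see. *)
Lemma bar_pairingE (a b : I1 K) :
  bar_pairing (bar a) (bar b) = pairing (\val a) (\val b).
Proof. by apply: pairing_congr; exact: repr_one_units. Qed.

End Ideles.

(** * Constants, residues in the completions, principal ideles and divisor classes *)

Section Constants.
Variables (k : closedFieldType) (X : smooth_complete_curve k).
Variable K : forall x : pt X, completion (ord x).

(** The local ring at x is a localization of a k-algebra, and by smoothness it is the valuation
    ring. *)
Lemma scal_integral (x : pt X) c : vge (ord x) 0 (scal X c).
Proof.
suff : stalk x (scal X c) by rewrite smooth.
have [charts [_ /(_ x)[s _ [m [_ m1 _] ->]] _]] := charts_cover X.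
have const d : generated_algebra (scal X) s (scal X d).
  by move=> B [[+ _ _] _]; apply.
exists (scal X c), 1; split; rewrite ?divr1 //.
by rewrite -(rmorph1 (scal X)).
Qed.

(** By density, a agrees modulo the maximal ideal with an integral function, to which
    [residue_exists] applies. *)
Lemma completion_residue (x : pt X) (a : K x) : vge (cval (K x)) 0 a ->
  exists c, vge (cval (K x)) 1 (a - cemb (K x) (scal X c)).
Proof.
have vE n f : vge (cval (K x)) n (cemb (K x) f) = vge (ord x) n f.
  rewrite /vge fmorph_eq0; case: eqVneq => //= f0.
  by rewrite cval_emb.
move=> a0; have [f af] := cemb_dense a 1.
have f0 : vge (ord x) 0 f.
  by rewrite -vE -[cemb _ f](subKr a) vgeB //; apply: vge_le af.
have [c fc] := residue_exists (@scal_integral x) (curve_dim X) f0.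
by exists c; rewrite -(subrKA (cemb (K x) f)) vgeD // -rmorphB vE.
Qed.

(** In its uses, the finiteness comes from f having the same valuations as an idele, or from f being
    constant. *)
Lemma principal_idele f : f != 0 -> finite_set [set x | ord x f != 0] ->
  exists a : idele K, forall x, icomp a x = cemb (K x) f.
Proof.
have restr g : g != 0 -> finite_set [set x | ord x g != 0] ->
    (fun x => cemb (K x) g) \in @restricted k X K.
  move=> g0 fin; apply/asboolP; apply: sub_finite_set fin => x /=.
  rewrite /vge fmorph_eq0 (negPf g0) /= cval_emb // -ltNge => h.
  by rewrite lt_eqF.
move=> f0 fin; have finV : finite_set [set x | ord x f^-1 != 0].
  by apply: sub_finite_set fin => x /=; rewrite dvalV // oppr_eq0.
pose a := Adele (restr _ f0 fin).
pose b := Adele (restr _ (invr_neq0 f0) finV).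
have ab : a * b = 1.
  apply: val_inj; apply: functional_extensionality_dep => x.
  by rewrite adeleME /= -rmorphM divff // rmorph1.
by exists (mk_idele ab).
Qed.

Lemma principal1 : principal K 1%g.
Proof. by exists 1; rewrite ?oner_eq0 // => x; rewrite rmorph1. Qed.

Lemma principalM a b : principal K a -> principal K b -> principal K (a * b)%g.
Proof.
move=> [f f0 af] [g g0 bg]; exists (f * g); first by rewrite mulf_neq0.
by move=> x; rewrite icompM af bg rmorphM.
Qed.

Lemma principalV a : principal K a -> principal K (a^-1)%g.
Proof.
move=> [f f0 af]; exists f^-1; first by rewrite invr_neq0.
by move=> x; rewrite icompV af fmorphV.
Qed.

Lemma icoset_self a : icoset (principal K) a a.
Proof. by exists 1%g; [exact: principal1|rewrite mulg1]. Qed.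

Lemma idele_mulC (a b : idele K) : (a * b)%g = (b * a)%g.
Proof. by apply: val_inj; rewrite /= mulrC. Qed.

Lemma icoset_eq (a b : idele K) : principal K (a * b^-1)%g ->
  icoset (principal K) a = icoset (principal K) b.
Proof.
have h (c d : idele K) : principal K (c * d^-1)%g ->
    icoset (principal K) c `<=` icoset (principal K) d.
  move=> cd _ [g pg <-]; exists (c * d^-1 * g)%g; first exact: principalM.
  by rewrite mulgA [(d * _)%g]idele_mulC mulgVK.
move=> ab; apply/seteqP; split; first exact: h.
by apply: h; have := principalV ab; rewrite invgM invgK.
Qed.

Lemma div_class_eq (a b : I1 K) :
  div_class a = div_class b <->
  exists2 f : fun_field X, f != 0 &
    forall x, cval (K x) (icomp (\val a) x) = cval (K x) (icomp (\val b) x) + ord x f.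
Proof.
have -> : (div_class a = div_class b) <->
    MkDiv0 (idele_div_degree0 a) - MkDiv0 (idele_div_degree0 b) \in @principal_div k X.
  by rewrite Quotient.idealrBE; split=> /eqP.
split=> [/asboolP|] [f f0 h]; [|apply/asboolP]; exists f => // x; have := h x.
  by rewrite raddfB /= !coeff_idele_div => <-; rewrite addrC subrK.
by rewrite raddfB /= !coeff_idele_div => ->; rewrite addrC addKr.
Qed.

(** Makes the map from cosets to divisor classes well defined. *)
Lemma div_class_icoset (a b : I1 K) :
  icoset (principal K) (\val a) = icoset (principal K) (\val b) ->
  div_class a = div_class b.
Proof.
move=> ab; have := icoset_self (\val a); rewrite ab => -[g [f f0 gf] ba].
apply/div_class_eq; exists f => // x.
by rewrite -ba icompM dvalM ?icomp_neq0 // gf cval_emb.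
Qed.

Lemma div_classM (a b c : I1 K) : \val c = (\val a * \val b)%g ->
  div_class c = div_class a + div_class b.
Proof.
move=> cab; transitivity (\pi_(Quotient.quot (@principal_div k X))
  (MkDiv0 (idele_div_degree0 a) + MkDiv0 (idele_div_degree0 b))); last exact: raddfD.
congr (\pi _); apply: val_inj => /=.
by rewrite cab idele_divM.
Qed.

End Constants.

(** * The field Omega: vanishing, discreteness and divisor classes *)

Section Field.
Variables (k : closedFieldType) (X : smooth_complete_curve k).
Variable K : forall x : pt X, completion (ord x).
Variable Omega : {pred adele K}.
Hypothesis Omega_field : is_subfield Omega.
Hypothesis Omega_deg0 : units_of Omega `<=` I1 K.
Implicit Types (a b : idele K).

Lemma units_of_subr a b : units_of Omega a -> units_of Omega b ->
  val a - val b \in Omega.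
Proof. by case: Omega_field => -[_ + _] _ _ [? _] [? _]; apply. Qed.

Lemma units_ofM a b : units_of Omega a -> units_of Omega b -> units_of Omega (a * b)%g.
Proof.
case: Omega_field => -[_ _ M] _ _ [a1 a2] [b1 b2].
by split; rewrite ?invgM; apply: M.
Qed.

Lemma units_ofV a : units_of Omega a -> units_of Omega (a^-1)%g.
Proof. by case=> ? ?; split; rewrite ?invgK. Qed.

Lemma Omega_unit w : w \in Omega -> w != 0 -> exists2 a, units_of Omega a & val a = w.
Proof.
case: Omega_field => _ _ inv wO w0; have [b bO wb] := inv w wO w0.
by exists (mk_idele wb) => //; split=> //; rewrite (val_ideleV (c := b)).
Qed.

(* A nonzero element of Omega is an idele of degree 0. *)
Lemma Omega_vanish w E : w \in Omega -> U_ K E w -> 0 < deg E -> w = 0.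
Proof.
move=> wO wE E0; apply/eqP/negPn/negP => w0.
have [a aO aw] := Omega_unit wO w0.
have := Omega_deg0 aO; rewrite /I1 /= => da.
have : deg E <= deg (idele_div a).
  apply: deg_le => x; rewrite coeff_idele_div; have := wE x.
  by rewrite /vge -aw -/(icomp a x) (negPf (icomp_neq0 a x)).
by rewrite da leNgt E0.
Qed.

(** With no closed point the adele ring would be zero, whereas 1 != 0 in Omega. *)
Lemma pt_inhabited : inhabited (pt X).
Proof.
apply: contrapT => no; case: Omega_field => _ /eqP + _; apply.
apply: val_inj; apply: functional_extensionality_dep => x.
by case: no; exists.
Qed.

(** Equivalently, b / a - 1 is integral everywhere and lies in the maximal ideal at x0. The summand
    x0 makes the degree of the divisor positive when a has degree 0. *)
Definition coset_nbhd (x0 : pt X) a : set (idele K) :=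
  [set b | U_ K (idele_div a + << x0 >>) (val b - val a)].

Lemma coset_nbhd_self x0 a : coset_nbhd x0 a a.
Proof. by rewrite /coset_nbhd /= subrr; exact: U_0. Qed.

Lemma coset_nbhd_units x0 a b : units_of Omega a -> units_of Omega b ->
  coset_nbhd x0 a b -> b = a.
Proof.
move=> aO bO /Omega_vanish => /(_ (units_of_subr bO aO)).
rewrite degD degU (Omega_deg0 aO) => /(_ isT)/eqP.
by rewrite subr_eq0 => /eqP/val_inj.
Qed.

(** Write b' - a = (b' - b) + (b - a) with b' - b = b (u - 1), where v(b) >= v(a). *)
Lemma coset_nbhd_one_units x0 a b b' : one_units (b' * b^-1)%g ->
  coset_nbhd x0 a b -> coset_nbhd x0 a b'.
Proof.
set u := (_ * _)%g => uu ab x; have -> : b' = (u * b)%g by rewrite mulgVK.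
have := ab x; rewrite coeffD coeff_idele_div coeffU mul1r !adeleDE !adeleNE.
rewrite -!/(icomp _ x) icompM => vab.
have vb : vge (cval (K x)) (cval (K x) (icomp a x)) (icomp b x).
  rewrite -[icomp b x](subrK (icomp a x)) vgeD ?vge_dval //.
  by apply: vge_le vab; rewrite lerDl.
rewrite -(subrKA (icomp b x)) vgeD //.
have -> : icomp u x * icomp b x - icomp b x = icomp b x * (icomp u x - 1).
  by rewrite mulrBr mulr1 mulrC.
(* The bound v(u - 1) >= 1 covers the extra 1 required at x0. *)
by apply: vge_le (vgeM vb (uu x)); rewrite lerD2l; case: (x0 == x).
Qed.

(** The neighbourhood is saturated for one-units, so membership may be tested on any representative
    and descends to the quotient. *)
Lemma coset_nbhd_bar x0 a (b : I1 K) :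
  coset_nbhd x0 a (\val (repr (bar b : {eq_quot (one_units_equiv K)}))) <->
  coset_nbhd x0 a (\val b).
Proof.
have := repr_one_units b.
by split; apply: coset_nbhd_one_units => //; 
  have := one_unitsV (repr_one_units b); rewrite invgM invgK.
Qed.

Lemma Omega_discrete : discrete_subset (units_of Omega).
Proof.
have [x0] := pt_inhabited.
apply: discrete_subsetP => a aO; exists (coset_nbhd x0 a).
  exact: open_idele_coset.
by split=> [|b bO]; [exact: coset_nbhd_self|exact: coset_nbhd_units].
Qed.

Lemma bar_Omega_inj (a b : I1 K) : units_of Omega (\val a) -> units_of Omega (\val b) ->
  bar a = bar b -> a = b.
Proof.
have [x0] := pt_inhabited => aO bO ab; apply/esym/val_inj.
apply: (coset_nbhd_units (x0 := x0)) => //; apply/coset_nbhd_bar.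
by rewrite -ab; apply/coset_nbhd_bar; exact: coset_nbhd_self.
Qed.

Lemma bar_Omega_discrete (B : set (barI1 K)) : discrete_subset
  (\val @^-1` (bar @` [set a : I1 K | units_of Omega (\val a)]) : set B).
Proof.
have [x0] := pt_inhabited.
apply: discrete_subset_preimage => _ [a aO <-].
exists [set q : barI1 K |
  coset_nbhd x0 (\val a) (\val (repr (q : {eq_quot (one_units_equiv K)})))].
  (* For the quotient topology, openness is that of the preimage in [I1], which is the trace of the
     neighbourhood. *)
  exists (coset_nbhd x0 (\val a)); first exact: open_idele_coset.
  by apply/seteqP; split=> b /coset_nbhd_bar.
split; first by apply/coset_nbhd_bar; exact: coset_nbhd_self.
move=> _ [b bO <-] /coset_nbhd_bar h; congr bar; apply: val_inj.
exact: coset_nbhd_units h.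
Qed.

Hypothesis Sigma_sub : principal K `<=` units_of Omega.

Lemma Omega_div_class_inj (a b : I1 K) :
  units_of Omega (\val a) -> units_of Omega (\val b) ->
  div_class a = div_class b -> principal K (\val a * (\val b)^-1)%g.
Proof.
move=> aO bO /div_class_eq[f f0 abf]; have [x0] := pt_inhabited.
have ordE x : ord x f = cval (K x) (icomp (\val a * (\val b)^-1)%g x).
  by rewrite icompM icompV dvalM ?invr_neq0 ?icomp_neq0 // dvalV ?icomp_neq0 // abf addrC addKr.
(* The valuations of f are those of the idele a / b, hence almost all zero, and f defines a
   principal idele g. *)
have fin : finite_set [set x | ord x f != 0].
  by under eq_set do rewrite ordE; exact: finite_idele_supp.
have [g gf] := principal_idele K f0 fin.
have gp : principal K g by exists f.
pose c := (\val a * (\val b)^-1 * g^-1)%g.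
have cO : units_of Omega c.
  apply: units_ofM; first by apply: units_ofM => //; exact: units_ofV.
  by apply: units_ofV; exact: Sigma_sub.
have vc x : cval (K x) (icomp c x) = 0.
  by rewrite icompM dvalM ?icomp_neq0 // -ordE icompV dvalV ?icomp_neq0 // gf cval_emb // subrr.
have [|l cl] := @completion_residue _ _ K x0 (icomp c x0).
  by rewrite -(vc x0) vge_dval.
(* A zero residue would put c, which has valuation 0, in the maximal ideal at x0. *)
have l0 : l != 0.
  apply/eqP => l0; move: cl; rewrite l0 !rmorph0 subr0 /vge vc.
  by rewrite (negPf (icomp_neq0 c x0)).
have sl0 : scal X l != 0 by rewrite fmorph_eq0.
have ordl x : ord x (scal X l) = 0 := dval_scal (@scal_integral _ X x) l0.
have [|h hl] := principal_idele K sl0.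
  by rewrite (_ : [set _ | _] = set0) //; apply/seteqP; split=> // x /=; rewrite ordl eqxx.
have hp : principal K h by exists (scal X l).
(* With h the constant idele l, c - h is integral everywhere and lies in the maximal ideal at x0;
   the divisor x0 has degree 1. *)
suff ch : c = h.
  have -> : (\val a * (\val b)^-1 = h * g)%g by rewrite -ch mulgVK.
  exact: principalM.
apply/val_inj/eqP; rewrite -subr_eq0; apply/eqP.
apply: (@Omega_vanish _ << x0 >>); [|move=> x|by rewrite degU].
  by apply: units_of_subr => //; exact: Sigma_sub.
rewrite adeleDE adeleNE -!/(icomp _ x) hl coeffU mul1r.
case: eqVneq => [<- //|_]; apply: (@vgeB _ _ 0); first by rewrite -(vc x) vge_dval.
by rewrite -(ordl x) -(cval_emb (K x)) // vge_dval.
Qed.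

End Field.

(** * Discreteness of Omega^* and its embedding modulo Sigma_X^* into Pic^0 *)

Theorem theorem5p10 (k : closedFieldType) (X : smooth_complete_curve k)
    (K : forall x : pt X, completion (ord x))
    (Omega : {pred adele K}) (Omega_field : is_subfield Omega)
    (Sigma_sub : principal K `<=` units_of Omega)
    (Omega_sub : units_of Omega `<=` perp (principal K)) :
  let Omega1 := [set a : I1 K | units_of Omega (\val a)] in
  let target := bar_perp (bar_principal K) in
  [/\ discrete_subset (units_of Omega),
      [/\ bar @` Omega1 `<=` target,
          {in Omega1 &, injective bar} &
          discrete_subset (\val @^-1` (bar @` Omega1) : set target)] &
      exists phi : set (idele K) -> Pic0 X,
        [/\ forall a : I1 K, units_of Omega (\val a) ->
              phi (icoset (principal K) (\val a)) = div_class a,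
            forall a b : idele K, units_of Omega a -> units_of Omega b ->
              phi (icoset (principal K) (a * b)%g) =
              phi (icoset (principal K) a) + phi (icoset (principal K) b) &
            {in [set icoset (principal K) a | a in units_of Omega] &,
              injective phi}]].
Proof.
have deg0 : units_of Omega `<=` I1 K by move=> a /Omega_sub[].
move=> Omega1 target; split; first exact: Omega_discrete.
  split.
  - move=> _ [a aO <-] _ [g gp <-]; rewrite bar_pairingE.
    by have [_] := Omega_sub _ aO; apply.
  - move=> a b /set_mem aO /set_mem bO.
    exact: (bar_Omega_inj Omega_field deg0 aO bO).
  - exact: bar_Omega_discrete.
(* The class of the divisor of a chosen representative of degree 0; the value 0 is a default for
   sets that are not cosets of such ideles. *)
pose phi (G : set (idele K)) : Pic0 X :=
  if pselect (exists a : I1 K, G = icoset (principal K) (\val a)) is left h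
  then div_class (sval (cid h)) else 0.
have phiE (a : I1 K) : phi (icoset (principal K) (\val a)) = div_class a.
  rewrite /phi; case: pselect => [h|[]]; last by exists a.
  by apply: div_class_icoset; rewrite -(svalP (cid h)).
have lift a : units_of Omega a -> exists b : I1 K, \val b = a.
  by move=> /deg0 /mem_set a1; exists (exist _ a a1).
exists phi; split=> // [a b aO bO|].
  have [c ca] := lift _ aO; have [d db] := lift _ bO.
  have [e eab] := lift _ (units_ofM Omega_field aO bO).
  by rewrite -eab -ca -db !phiE; apply: div_classM; rewrite eab ca db.
move=> _ _ /set_mem[a aO <-] /set_mem[b bO <-].
have [c ca] := lift _ aO; have [d db] := lift _ bO.
rewrite -ca -db !phiE in aO bO * => cd; apply: icoset_eq.
exact: (Omega_div_class_inj Omega_field deg0 Sigma_sub).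
Qed.
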